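(* Let $n$ be a positive integer and let $\lambda,\mu,\nu$ be partitions such that $\ell(\lambda)\le n$ and $\mu,\nu\subseteq\lambda$ with $|\lambda|=|\mu|+|\nu|$. For each LR hive $K\in\mathcal{H}^{(n)}(\lambda,\nu,\mu)$ with upright rhombus gradients $V_{ij}$, $1\le i<j\le n$, let $$\overline{\theta}_r=\overline{\chi}_r^{\,\nu_r}\,\overline{\phi}_1^{\,V_{1r}}\,\overline{\phi}_2^{\,V_{2r}}\cdots\overline{\phi}_{r-1}^{\,V_{r-1,r}}\,\overline{\omega}_r^{\,\mu_r-V_{r,n}-V_{r,n-1}-\cdots-V_{r,r+1}}$$ (operators act with the rightmost first). Then the successive application of $\overline{\theta}_r\kappa_r^{-1}$ for $r=1,2,\dots,n$ to the empty hive $H^{(0)}$ yields $$H:=\overline{\theta}_n\kappa_n^{-1}\cdots\overline{\theta}_2\kappa_2^{-1}\,\overline{\theta}_1\kappa_1^{-1}\,H^{(0)}\in\mathcal{H}^{(n)}(\lambda,\mu,\nu).$$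
   Context: Partitions. A partition has weakly decreasing nonnegative integer parts; $\ell(\lambda)$ is the number of positive parts, $|\lambda|$ the sum of the parts, and $\mu\subseteq\lambda$ means $\mu_i\le\lambda_i$ for all $i$. Partitions of length $\le n$ are padded with zeros to $n$ parts. Hives. An integer $n$-hive is a family of integers $a_{ij}$ ($0\le i\le j\le n$), $a_{00}=0$ (vertex labels of a triangular array of side $n$), with edge labels $\alpha_{ij}=a_{ij}-a_{i,j-1}$ ($0\le i<j\le n$), $\beta_{ij}=a_{ij}-a_{i-1,j}$, $\gamma_{ij}=a_{ij}-a_{i-1,j-1}$ ($1\le i\le j\le n$), such that for all $1\le i<j\le n$ the gradients $R_{ij}=\alpha_{i-1,j-1}-\alpha_{ij}$, $U_{ij}=\alpha_{ij}-\alpha_{i-1,j}=\beta_{ij}-\beta_{i,j-1}$, $L_{ij}=\beta_{i,j-1}-\beta_{i+1,j}$ are $\ge0$. Edge labels satisfy the triangle conditions $\gamma_{ij}=\alpha_{i-1,j}+\beta_{ij}$ and $\gamma_{ij}=\beta_{i,j-1}+\alpha_{ij}$ ($i<j$) and determine the hive. $U_{ij}$ is the $(i,j)$ upright rhombus gradient; the $j$-th diagonal comprises the upright rhombi $(i,j)$, $i=1,\dots,j-1$, and the triangle with bottom edge $\gamma_{jj}$. An LR hive is an integer hive with all edge labels $\ge0$. $\mathcal{H}^{(n)}(\lambda,\mu,\nu)$ is the set of LR $n$-hives with lower boundary $\gamma_{kk}=\lambda_k$, left boundary $\alpha_{0k}=\mu_k$, right boundary $\beta_{kn}=\nu_k$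 ($1\le k\le n$); thus $K\in\mathcal{H}^{(n)}(\lambda,\nu,\mu)$ has left boundary $\nu$ and right boundary $\mu$. The empty hive $H^{(0)}$ is the $0$-hive (a single vertex). Path additions. These act on integer-labelled triangular arrays of side $r$ satisfying the triangle conditions and with all upright gradients $U_{ij}\ge0$ (the conditions $R_{ij},L_{ij}\ge0$ are not required), changing edge labels as follows. $\overline{\chi}_r$: increase $\beta_{rr}$ and $\gamma_{rr}$ by 1. $\overline{\omega}_r$: increase by 1 all $\alpha_{ir}$ ($0\le i<r$) and all $\gamma_{ir}$ ($1\le i\le r$). $\overline{\phi}_k$ ($1\le k<r$): a path proceeds down the $k$-th diagonal from the left boundary edge $\alpha_{0k}$ through upright rhombi of gradient $0$ until it meets one of positive gradient, or the base, then moves right into the next diagonal, and so on; once in the $r$-th diagonal it goes straight down to $\gamma_{rr}$. Explicitly: put $s_k=1$; for $k\le d<r$ let $i_d=\min\{i: s_d\le i<d,\ U_{id}>0\}$ if this set is nonempty and $i_d=d$ otherwise, and put $s_{d+1}=i_d+1$; put $i_r=r$. Increase by 1 the labels $\alpha_{id}$ for $s_d-1\le i\le i_d-1$ and $\gamma_{id}$ for $s_d\le i\le i_d-1$ ($k\le d\le r$) and the label $\gamma_{rr}$; decrease by 1 the labels $\beta_{i_d,d}$ ($k\le d<r$). The operator $\kappa_r^{-1}$ turns an array of side $r-1$ into one of side $r$ by adding an $r$-th diagonal whose upright rhombus gradients and upper and lower boundary edge labels are all $0$, i.e. $\alpha_{ir}=0$ ($0\le i<r$), $\beta_{ir}=\gamma_{ir}=\beta_{i,r-1}$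 ($1\le i<r$), $\beta_{rr}=\gamma_{rr}=0$. *)

(* Defs.v *)
From mathcomp Require Import all_boot all_order all_algebra.

Set Implicit Arguments.
Unset Strict Implicit.
Unset Printing Implicit Defensive.
Import Order.TTheory GRing.Theory Num.Theory.
Local Open Scope ring_scope.

(* A partition is a weakly decreasing sequence of naturals (trailing zeros are
   allowed); [part la i] is its i-th part, counted from 1 and zero-padded. *)
Definition is_partition (la : seq nat) : bool := sorted geq la.
Definition part (la : seq nat) (i : nat) : nat := nth 0%N la i.-1.
Definition plen (la : seq nat) : nat := count (fun p => (0 < p)%N) la.
Definition psize (la : seq nat) : nat := sumn la.
Definition psub (mu la : seq nat) : Prop :=
  forall i : nat, (1 <= i)%N -> (part mu i <= part la i)%N.

(* Edge labels of a triangular array of side r.  Only the labels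
     al i j (0 <= i < j <= r),  be i j and ga i j (1 <= i <= j <= r)
   belong to the array; the values at other indices are irrelevant. *)
Record labels := Labels {
  al : nat -> nat -> int;
  be : nat -> nat -> int;
  ga : nat -> nat -> int }.

Definition edges (a : nat -> nat -> int) : labels :=
  Labels (fun i j => a i j - a i j.-1)
         (fun i j => a i j - a i.-1 j)
         (fun i j => a i j - a i.-1 j.-1).

Definition eq_labels (r : nat) (E F : labels) : Prop :=
  (forall i j : nat, (i < j <= r)%N -> al E i j = al F i j) /\
  (forall i j : nat, (1 <= i <= j)%N -> (j <= r)%N ->
     be E i j = be F i j /\ ga E i j = ga F i j).

Definition Rgrad (E : labels) (i j : nat) : int := al E i.-1 j.-1 - al E i j.
Definition Ugrad (E : labels) (i j : nat) : int := al E i j - al E i.-1 j.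
Definition Lgrad (E : labels) (i j : nat) : int := be E i j.-1 - be E i.+1 j.

(* Vertex labels a i j, 0 <= i <= j <= n. *)
Definition is_hive (n : nat) (a : nat -> nat -> int) : Prop :=
  a 0%N 0%N = 0 /\
  forall i j : nat, (1 <= i < j)%N -> (j <= n)%N ->
    [/\ 0 <= Rgrad (edges a) i j, 0 <= Ugrad (edges a) i j
      & 0 <= Lgrad (edges a) i j].

Definition is_LR_hive (n : nat) (a : nat -> nat -> int) : Prop :=
  [/\ is_hive n a,
      forall i j : nat, (i < j <= n)%N -> 0 <= al (edges a) i j
    & forall i j : nat, (1 <= i <= j)%N -> (j <= n)%N ->
        0 <= be (edges a) i j /\ 0 <= ga (edges a) i j].

Definition LR_hives (n : nat) (la mu nu : seq nat) (a : nat -> nat -> int) :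
    Prop :=
  is_LR_hive n a /\
  forall k : nat, (1 <= k <= n)%N ->
    [/\ ga (edges a) k k = (part la k)%:Z,
        al (edges a) 0%N k = (part mu k)%:Z
      & be (edges a) k n = (part nu k)%:Z].

Definition chi (r : nat) (E : labels) : labels :=
  let c (i j : nat) : int := if (i == r) && (j == r) then 1 else 0 in
  Labels (al E)
         (fun i j => be E i j + c i j)
         (fun i j => ga E i j + c i j).

Definition omega (r : nat) (E : labels) : labels :=
  Labels (fun i j => al E i j + (if (i < r)%N && (j == r) then 1 else 0))
         (be E)
         (fun i j => ga E i j + (if (1 <= i <= r)%N && (j == r) then 1 else 0)).

(* The row at which a path that entered the d-th diagonal at row s leaves it:
   the least i with s <= i < d and positive upright gradient, or else d. *)
Definition turn (E : labels) (s d : nat) : nat :=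
  head d [seq i <- index_iota s d | 0 < Ugrad E i d].

(* [entry_rec E k m] is s_{k+m}. *)
Fixpoint entry_rec (E : labels) (k m : nat) : nat :=
  if m is m'.+1 then (turn E (entry_rec E k m') (k + m')).+1 else 1%N.

(* s_d and i_d, for k <= d <= r *)
Definition entry (E : labels) (k d : nat) : nat := entry_rec E k (d - k).
Definition exit (r : nat) (E : labels) (k d : nat) : nat :=
  if (d < r)%N then turn E (entry E k d) d else r.

Definition phi (r k : nat) (E : labels) : labels :=
  let s := entry E k in
  let x := exit r E k in
  Labels
    (fun i d => al E i d +
       (if (k <= d <= r)%N && ((s d).-1 <= i <= (x d).-1)%N then 1 else 0))
    (fun i d => be E i d -
       (if (k <= d < r)%N && (i == x d) then 1 else 0))
    (fun i d => ga E i d +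
       (if (k <= d <= r)%N && (s d <= i)%N && (i < x d)%N
           || (i == r) && (d == r) then 1 else 0)).

Definition kappa_inv (r : nat) (E : labels) : labels :=
  Labels
    (fun i j => if j == r then 0 else al E i j)
    (fun i j => if j == r then (if (i < r)%N then be E i r.-1 else 0)
                else be E i j)
    (fun i j => if j == r then (if (i < r)%N then be E i r.-1 else 0)
                else ga E i j).

Definition omega_exp (n : nat) (mu : seq nat) (V : nat -> nat -> int)
    (r : nat) : int :=
  (part mu r)%:Z - \sum_(r.+1 <= j < n.+1) V r j.

(* The exponents are nonnegative when V comes from a hive K as in the theorem
   (see [omega_exp_ge0]), so passing to absolute values changes nothing.
   [foldr] makes phi_{r-1} act first, right after omega, and phi_1 last. *)
Definition theta (n : nat) (mu nu : seq nat) (V : nat -> nat -> int)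
    (r : nat) (E : labels) : labels :=
  iter (part nu r) (chi r)
    (foldr (fun k => iter `|V k r|%N (phi r k))
           (iter `|omega_exp n mu V r|%N (omega r) E)
           (index_iota 1 r)).

Definition empty_hive : labels :=
  Labels (fun _ _ => 0) (fun _ _ => 0) (fun _ _ => 0).

(* theta_r kappa_r^{-1} ... theta_1 kappa_1^{-1} H^(0) *)
Fixpoint build (n : nat) (mu nu : seq nat) (V : nat -> nat -> int) (r : nat) :
    labels :=
  if r is r'.+1 then
    theta n mu nu V r (kappa_inv r (build n mu nu V r'))
  else empty_hive.

Lemma omega_exp_ge0 (n : nat) (la mu nu : seq nat) (K : nat -> nat -> int)
    (r : nat) :
  LR_hives n la nu mu K -> (1 <= r <= n)%N ->
  0 <= omega_exp n mu (Ugrad (edges K)) r.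
Proof.
move=> [[_ _ be_ge0] bd] /andP[r1 rn].
have [_ _ bEr] := bd r (introT andP (conj r1 rn)).
have -> : omega_exp n mu (Ugrad (edges K)) r = be (edges K) r r.
  rewrite /omega_exp -bEr.
  have -> : \sum_(r.+1 <= j < n.+1) Ugrad (edges K) r j =
            be (edges K) r n - be (edges K) r r.
    rewrite big_add1 -(telescope_sumr (be (edges K) r)) //.
    apply: eq_bigr => j _; rewrite /Ugrad /=.
    by rewrite !opprB addrACA [RHS]addrACA [X in _ + X = _]addrC.
  by rewrite subKr.
by have [] := be_ge0 r r; rewrite ?r1 ?leqnn.
Qed.

(* Main.v *)
Require Import Defs.
From mathcomp Require Import all_boot all_order all_algebra zify.

Set Implicit Arguments.
Unset Strict Implicit.
Unset Printing Implicit Defensive.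
Import Order.TTheory GRing.Theory Num.Theory.
Local Open Scope ring_scope.

(** Let [h_r] be the vertex labels of the array built after [r] rounds.  The
    arrays are stacked: put [f(i, d, r) = h_r(i, d) + K(0, r)] on the tetrahedron
    [0 <= i <= d <= r <= n].  The theorem holds because [f] solves the
    octahedron recurrence
<<
      f(i, d, r) + f(i+1, d+1, r+1)
        = max (f(i, d, r+1) + f(i+1, d+1, r),  f(i, d+1, r+1) + f(i+1, d, r))
>>
    with boundary values [f(0, d, r) = K(d, r)], [f(d, d, r) = K(d, d) + K(0, r)]
    and [f(i, r, r) = K(r, r) + K(0, i)], and this recurrence carries the hive
    inequalities of the face [i = 0], which is [K], to every slice of constant
    [r], in particular to the slice [r = n], which is [H] up to a constant.  The
    three boundary edges of [H] are read off the boundary values: its left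
    boundary is the edge of the tetrahedron that it shares with [K], its lower
    and right boundaries come from the faces [i = d] and [d = r].

    That the path additions solve the recurrence is a statement about row
    insertion.  Read the upright gradients of diagonal [d] as the content of
    row [d] of a skew tableau; then a path is a bumping route, which starts with
    a new blank in row [k].  In one round all the paths together feed a weakly
    increasing word into each row, and inserting such a word is a queue: the
    number of letters bumped so far is the minimum of what has arrived and what
    could have been served.  In terms of the total rise of the vertices this is
    the function [push], a maximum of two terms ([push_raised] adds one path,
    [slice_build] a whole round), and rewritten in vertex labels it is the
    recurrence ([tetra_rec]).

    For the propagation ([octahedral_slice_hive]) one proves an inequality for
    a family of unit rhombi in each of four directions of lattice planes, each
    family by induction on the position of its far vertex.  The recurrence says
    nothing at the vertices [i = d = r], where the new part of [nu] is put in;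
    there the inequality, [be (r-1) (r-1) >= nu_r], comes from the boundary
    values and the hive inequalities in the planes of constant [i]
    ([rhombus_corner]). *)

(** * The octahedron recurrence preserves hives *)

(** Of the octahedra with vertices [f i d r] and [f i.+1 d.+1 r.+1], those on
    the faces [d = r] and [i = d] of the tetrahedron lose the vertex
    [f i.+1 d.+1 r], respectively [f i.+1 d r].  The three clauses read the
    recurrence with a lost vertex counted as minus infinity, so that boundary
    octahedra need no separate treatment below.  The octahedra at [i = d = r]
    lose both vertices, and nothing is required of them. *)
Record octahedral (n : nat) (f : nat -> nat -> nat -> int) : Prop :=
  Octahedral {
    oct_geB : forall i d r, (i <= d < r)%N -> (r < n)%N ->
      f i d r.+1 + f i.+1 d.+1 r <= f i d r + f i.+1 d.+1 r.+1;
    oct_geC : forall i d r, (i < d <= r)%N -> (r < n)%N ->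
      f i d.+1 r.+1 + f i.+1 d r <= f i d r + f i.+1 d.+1 r.+1;
    oct_max : forall i d r, (i <= d <= r)%N -> (i < r < n)%N ->
      ((d < r)%N /\
        f i d r + f i.+1 d.+1 r.+1 = f i d r.+1 + f i.+1 d.+1 r) \/
      ((i < d)%N /\
        f i d r + f i.+1 d.+1 r.+1 = f i d.+1 r.+1 + f i.+1 d r) }.

(** The octahedra and tetrahedra that fill the region meet in lattice planes of
    four directions: constant [i], constant [r], constant [d], constant
    [i - d + r].  A unit rhombus in one of these planes either has a short
    diagonal at the far vertex of an octahedron, or it lies across an edge of
    the equator of one.  The first kind follows from the second and one instance
    of the recurrence.  In each direction there is one family of the second
    kind, and it is proved from itself: the far vertex of the rhombus is
    replaced by the value that realises the maximum, and the remaining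
    inequality is a sum of an earlier member of the same family and one
    recurrence inequality, or a hive inequality of the face [i = 0]. *)
Section Rhombi.
Variables (n : nat) (f : nat -> nat -> nat -> int).
Hypotheses (octf : octahedral n f) (hive0 : is_hive n (f 0%N)).

Lemma face0_R d r : (d <= r)%N -> (r.+2 <= n)%N ->
  f 0%N d.+1 r.+2 + f 0%N d r <= f 0%N d r.+1 + f 0%N d.+1 r.+1.
Proof.
move=> dr rn; have [_ /(_ d.+1 r.+2)] := hive0.
case; [by lia..|]; rewrite /Rgrad /Ugrad /Lgrad /=; lia.
Qed.

Lemma face0_U d r : (d < r)%N -> (r.+1 <= n)%N ->
  f 0%N d r.+1 + f 0%N d.+1 r <= f 0%N d r + f 0%N d.+1 r.+1.
Proof.
move=> dr rn; have [_ /(_ d.+1 r.+1)] := hive0.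
case; [by lia..|]; rewrite /Rgrad /Ugrad /Lgrad /=; lia.
Qed.

Lemma face0_L d r : (d < r)%N -> (r.+1 <= n)%N ->
  f 0%N d.+2 r.+1 + f 0%N d r <= f 0%N d.+1 r + f 0%N d.+1 r.+1.
Proof.
move=> dr rn; have [_ /(_ d.+1 r.+1)] := hive0.
case; [by lia..|]; rewrite /Rgrad /Ugrad /Lgrad /=; lia.
Qed.

Lemma rhombus_const_i i d r : (i <= d <= r)%N -> (r.+2 <= n)%N ->
  f i d.+1 r.+2 + f i d r <= f i d r.+1 + f i d.+1 r.+1.
Proof.
elim: i d r => [|i IHi] [|d] r idr rn //; try by apply: face0_R; lia.
have [[ltdr eqB]|[ltid eqC]] := @oct_max _ _ octf i d.+1 r.+1 ltac:(lia) ltac:(lia).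
  have := @oct_geB _ _ octf i d r ltac:(lia) ltac:(lia).
  by have := IHi d r ltac:(lia) ltac:(lia); lia.
have := @oct_geC _ _ octf i d.+1 r ltac:(lia) ltac:(lia).
by have := IHi d.+1 r ltac:(lia) ltac:(lia); lia.
Qed.

Lemma rhombus_const_d i d r : (i < d <= r)%N -> (r < n)%N ->
  f i.+1 d r.+1 + f i d r <= f i d r.+1 + f i.+1 d r.
Proof.
elim: d i r => [|d IHd] i [|r] idr rn; [by lia..|].
have [[ltdr eqB]|[ltid eqC]] := @oct_max _ _ octf i d r.+1 ltac:(lia) ltac:(lia).
  case: i => [|i] in idr eqB *; first by have := @face0_U d r.+1; lia.
  have := @oct_geB _ _ octf i d r.+1 ltac:(lia) ltac:(lia).
  by have := IHd i r.+1 ltac:(lia) ltac:(lia); lia.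
have := @oct_geC _ _ octf i d r ltac:(lia) ltac:(lia).
by have := IHd i r ltac:(lia) ltac:(lia); lia.
Qed.

Lemma rhombus_const_idr i d r : (i <= d < r)%N -> (r < n)%N ->
  f i.+1 d.+2 r.+1 + f i d r <= f i d.+1 r.+1 + f i.+1 d.+1 r.
Proof.
elim: r i d => [|r IHr] i d; [lia|elim: i d => [|i IHi] d idr rn].
  have [[ltdr eqB]|[ltid eqC]] := @oct_max _ _ octf 0%N d.+1 r.+1 ltac:(lia) ltac:(lia).
    have := @oct_geB _ _ octf 0%N d r ltac:(lia) ltac:(lia).
    by have := IHr 0%N d ltac:(lia) ltac:(lia); lia.
  by have := @face0_L d r.+1; lia.
have [[ltdr eqB]|[ltid eqC]] := @oct_max _ _ octf i.+1 d.+1 r.+1 ltac:(lia) ltac:(lia).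
  have := @oct_geB _ _ octf i.+1 d r ltac:(lia) ltac:(lia).
  by have := IHr i.+1 d ltac:(lia) ltac:(lia); lia.
have := @oct_geC _ _ octf i d r.+1 ltac:(lia) ltac:(lia).
by have := IHi d ltac:(lia) ltac:(lia); lia.
Qed.

Hypothesis diag_f : forall d r, (d <= r <= n)%N ->
  f d d r = f 0%N d d + f 0%N 0%N r.
Hypothesis last_f : forall i r, (i <= r <= n)%N ->
  f i r r = f 0%N r r + f 0%N 0%N i.

(** The octahedra at [i = d = r] carry no recurrence, so the corner value
    [f d.+2 d.+2 d.+2] is not controlled by its neighbours; the boundary values
    settle this case.  They turn it into a bound on [f d d.+1 d.+2].  One
    recurrence step expresses that value by boundary values and one increment of
    [f], in [r] or in [d] and [r] together, and the inequality in planes of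
    constant [i] bounds this increment by a boundary one. *)
Lemma rhombus_corner d : (d.+2 <= n)%N ->
  f d.+2 d.+2 d.+2 + f d d.+1 d.+2 <= f d.+1 d.+1 d.+2 + f d.+1 d.+2 d.+2.
Proof.
have f000 : f 0%N 0%N 0%N = 0 by case: hive0.
move=> dn; rewrite (@last_f d.+1 d.+2) ?(@diag_f d.+1 d.+2) ?(@diag_f d.+2 d.+2); try lia.
suff: f d d.+1 d.+2 <= f 0%N d.+1 d.+1 + f 0%N 0%N d.+1 by lia.
case: d dn => [|d] dn; first by have := @face0_R 0%N 0%N; lia.
have [[_ eqB]|[_ eqC]] := @oct_max _ _ octf d d.+1 d.+2 ltac:(lia) ltac:(lia).
  have eD0 := @diag_f d d.+2 ltac:(lia); have eD1 := @diag_f d d.+1 ltac:(lia).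
  have eL1 := @last_f d.+1 d.+2 ltac:(lia).
  by have := @rhombus_const_i d d d.+1 ltac:(lia) ltac:(lia); lia.
have eD1 := @diag_f d.+1 d.+2 ltac:(lia).
have eL1 := @last_f d d.+1 ltac:(lia); have eL2 := @last_f d d.+2 ltac:(lia).
by have := @rhombus_const_i d d.+1 d.+1 ltac:(lia) ltac:(lia); lia.
Qed.

Lemma rhombus_const_r i d r : (i < d < r)%N -> (r <= n)%N ->
  f i.+2 d.+1 r + f i d r <= f i.+1 d r + f i.+1 d.+1 r.
Proof.
elim: r i d => [|r IHr] i [|d] idr rn; [by lia..|].
have [eqi|ltir] : (i = d /\ r = d.+1)%N \/ (i.+1 < r)%N by lia.
  by case: eqi => -> ->; apply: rhombus_corner; lia.
have [[ltdr eqB]|[ltid eqC]] := @oct_max _ _ octf i.+1 d.+1 r ltac:(lia) ltac:(lia).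
  have := @oct_geB _ _ octf i d.+1 r ltac:(lia) ltac:(lia).
  by have := IHr i d.+1 ltac:(lia) ltac:(lia); lia.
have := @oct_geC _ _ octf i d r ltac:(lia) ltac:(lia).
by have := IHr i d ltac:(lia) ltac:(lia); lia.
Qed.

(** In a slice of constant [r] the left gradients are of equatorial type, while
    the right and upright ones have a short diagonal at the far vertex of an
    octahedron. *)
Lemma octahedral_slice_hive r i d : (r <= n)%N -> (1 <= i < d)%N -> (d <= r)%N ->
  let E := edges (fun i d => f i d r) in
  [/\ 0 <= Rgrad E i d, 0 <= Ugrad E i d & 0 <= Lgrad E i d].
Proof.
case: r i d => [|r] [|i] [|[|d]] //= rn id dr; try lia.
rewrite /Rgrad /Ugrad /Lgrad /=; split.
- have := @oct_geB _ _ octf i d r ltac:(lia) ltac:(lia).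
  by have := @rhombus_const_idr i d r; lia.
- have := @oct_geC _ _ octf i d.+1 r ltac:(lia) ltac:(lia).
  by have := @rhombus_const_d i d.+1 r; lia.
by have := @rhombus_const_r i d.+1 r.+1; lia.
Qed.

End Rhombi.

(** * Path additions as bumping *)

Lemma turnP (E : labels) s d : (s <= d)%N ->
  [/\ (s <= turn E s d <= d)%N,
      forall i, (s <= i < turn E s d)%N -> Ugrad E i d <= 0
    & (turn E s d < d)%N -> 0 < Ugrad E (turn E s d) d].
Proof.
rewrite /turn /index_iota => /subnKC; move: (d - s)%N => m.
elim: m s => [|m IHm] s sd /=; first by split=> [|i|] /=; lia.
case: (ltrP 0 (Ugrad E s d)) => Us /=; first by split=> [|i|] //=; lia.
have [lb below pos] := IHm s.+1 ltac:(lia); split=> [|i ltix|]; [lia| |by []].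
have [->//|ltsi] : i = s \/ (s < i)%N by lia.
by apply: below; lia.
Qed.

Lemma entry_start (E : labels) k : entry E k k = 1%N.
Proof. by rewrite /entry subnn. Qed.

Lemma entryS (E : labels) k d : (k <= d)%N ->
  entry E k d.+1 = (turn E (entry E k d) d).+1.
Proof. by move=> kd; rewrite /entry subSn //= subnKC. Qed.

Lemma entry_bounds (E : labels) k d : (0 < k <= d)%N -> (0 < entry E k d <= d)%N.
Proof.
case: d => [|d]; first by lia.
elim: d => [|d IHd] kd.
  by rewrite (_ : k = 1%N) ?entry_start; lia.
have [->|kled] : k = d.+2 \/ (k <= d.+1)%N by lia.
  by rewrite entry_start.
have := IHd ltac:(lia); rewrite (entryS E kled).
by case/andP=> _ /(turnP E)[]; lia.
Qed.

Lemma exit_bounds r (E : labels) k d : (0 < k <= d)%N -> (d <= r)%N ->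
  (entry E k d <= exit r E k d <= d)%N.
Proof.
move=> kd dr; have := entry_bounds E kd; rewrite /exit.
have [ltdr|] := ltnP d r; last by lia.
by case/andP=> _ /(turnP E)[]; lia.
Qed.

(** A path addition changes the edge labels as raising by one every vertex on one
    side of the path does.  In the [r]-th diagonal, which the path descends to
    the base, the base vertex is raised as well: no [be] decreases there. *)
Definition path_raise (r : nat) (E : labels) (k i d : nat) : int :=
  ((k <= d) && ((i < exit r E k d) || (d == r)))%N%:Z.

Lemma phi_edges r k (h : nat -> nat -> int) (E : labels) : (0 < k < r)%N ->
  eq_labels r (edges h) E ->
  eq_labels r (edges (fun i d => h i d + path_raise r E k i d)) (phi r k E).
Proof.
move=> kr [eq_al eq_bg]; rewrite /path_raise.
have step d : (d < r)%N -> (k <= d)%N ->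
    [/\ entry E k d.+1 = (exit r E k d).+1, (entry E k d <= exit r E k d <= d)%N,
       (exit r E k d.+1 <= d.+1)%N, (entry E k d.+1 <= exit r E k d.+1)%N
     & (0 < entry E k d)%N].
  move=> dr kd; have := @exit_bounds r E k d.+1; have := @exit_bounds r E k d.
  have := @entry_bounds E k d.
  have -> : entry E k d.+1 = (exit r E k d).+1 by rewrite entryS // /exit dr.
  by split=> //; lia.
have first_exit : (0 < exit r E k k <= k)%N.
  by have := @exit_bounds r E k k; rewrite entry_start; lia.
have last_exit : exit r E k r = r by rewrite /exit ltnn.
split=> [i|i] [|d]; try lia.
  move=> idr; have /= := eq_al i d.+1 idr.
  have [ltdk|ltkd|eqk] := ltngtP d.+1 k.
  - by move=> ?; rewrite /=; lia.
  - rewrite /=; have [||-> ? ? ? ?] := step d; [lia..|].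
    by case: (d.+1 =P r) => [eqr|]; rewrite ?eqr ?last_exit; do ?[case: ifP]; lia.
  by rewrite /= -eqk entry_start; rewrite -eqk in first_exit; do ?[case: ifP]; lia.
move=> id dr; have /= [] := eq_bg i d.+1 id dr.
have [ltdk|ltkd|eqk] := ltngtP d.+1 k.
- by rewrite /=; do ?[case: ifP]; lia.
- rewrite /=; have [||-> ? ? ? ?] := step d; [lia..|].
  by case: (d.+1 =P r) => [eqr|]; rewrite ?eqr ?last_exit; do ?[case: ifP]; lia.
by rewrite /= -eqk entry_start; rewrite -eqk in first_exit; do ?[case: ifP]; lia.
Qed.

(** The amount by which the vertex [(i, d)] has gone up after a whole batch of
    path additions, when [C d] paths have entered among the first [d] diagonals
    and [U] holds the upright gradients before the batch.  On the tableau side,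
    row [d] receives a weakly increasing word; the letters bumped out of it form
    a queue in which the letter [i] serves at most [U i d] waiting letters
    smaller than [i], and [C d - push U C i d] counts the bumped letters up to
    [i].  The last letter of the row serves everything that still waits, whence
    the value [0]. *)
Fixpoint push (U : nat -> nat -> int) (C : nat -> int) (i d : nat) : int :=
  if i is i'.+1 then
    if (i < d)%N then Num.max (push U C i' d.-1) (push U C i' d - U i d) else 0
  else C d.

Lemma push_diag U C d : push U C d.+1 d.+1 = 0.
Proof. by rewrite /= ltnn. Qed.

Lemma eq_push U C1 C2 r : (forall d, (d < r)%N -> C1 d = C2 d) ->
  forall i d, (d < r)%N -> push U C1 i d = push U C2 i d.
Proof.
move=> eqC; elim=> [|i IHi] d dr /=; first exact: eqC.
by case: ifP => // id; rewrite !IHi //; lia.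
Qed.

Lemma push_eq0 U C r :
  (forall i d, (0 < i < d)%N -> (d < r)%N -> 0 <= U i d) ->
  (forall d, (d < r)%N -> C d = 0) ->
  forall i d, (d < r)%N -> push U C i d = 0.
Proof.
move=> U_ge0 C0; elim=> [|i IHi] d dr /=; first exact: C0.
case: ifP => // id; rewrite !IHi; try lia.
by have := @U_ge0 i.+1 d; lia.
Qed.

Section Path.
Variables (U : nat -> nat -> int) (C : nat -> int) (r k : nat) (E : labels).
Hypothesis U_ge0 : forall i d, (0 < i < d)%N -> (d < r)%N -> 0 <= U i d.
Hypothesis Ugrad_E : forall i d, (i.+1 < d < r)%N ->
  Ugrad E i.+1 d = U i.+1 d + push U C i.+1 d - push U C i.+1 d.-1
                   - push U C i d + push U C i d.-1.

(** One more path, entering in the [k]-th diagonal. *)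
Definition raised (d : nat) : int := C d + (k <= d)%N%:Z.

(** One diagonal of the path.  It matters that the earlier paths of the batch
    entered in diagonal [k] or beyond: in no diagonal have they turned at a row
    later than this one does, i.e. [push] vanishes from its turning row on.
    Hence the first term of the maximum is [0] along the descent, and the present
    upright gradient tells whether the second term attains the maximum: if the
    gradient is [0] it does, and the maximum goes up with it; at the first
    positive gradient it is negative, and raising it by one changes nothing. *)
Lemma push_raised_row s d : (k <= d < r)%N -> (0 < s <= d)%N ->
  (forall i, (s <= i.+1)%N -> (i < d)%N -> push U C i d.-1 = 0) ->
  (forall i, (i < d)%N ->
     push U raised i d.-1 = push U C i d.-1 + (i.+1 < s)%N%:Z) ->
  let x := turn E s d in
  (forall i, (x <= i <= d)%N -> push U C i d = 0) /\
  (forall i, (i <= d)%N -> push U raised i d = push U C i d + (i < x)%N%:Z).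
Proof.
move=> kdr sd prev0 prevR x.
have [sx below pos] := @turnP E s d ltac:(lia); rewrite -/x in sx below pos.
have rec i : (i.+1 < d)%N ->
    push U C i.+1 d = Num.max (push U C i d.-1) (push U C i d - U i.+1 d).
  by move=> id /=; rewrite id.
have after0 i : (x <= i <= d)%N -> push U C i d = 0.
  elim: i => [|i IHi] ixd; first by lia.
  have [e|ltid] : i.+1 = d \/ (i.+1 < d)%N by lia.
    by rewrite -e push_diag.
  have Ui := @U_ge0 i.+1 d; have eUi := @Ugrad_E i d.
  have zi := prev0 i; have reci := rec i ltid.
  have [eqx|ltxi] : x = i.+1 \/ (x <= i)%N by lia.
    have zi1 := prev0 i.+1; rewrite eqx in pos; lia.
  by have := IHi; lia.
split=> // i; elim: i => [|i IHi] id; first by rewrite /= /raised; lia.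
have [e|ltid] : i.+1 = d \/ (i.+1 < d)%N by lia.
  by rewrite -e /= ltnn; lia.
have -> : push U raised i.+1 d
        = Num.max (push U raised i d.-1) (push U raised i d - U i.+1 d).
  by rewrite /= ltid.
rewrite prevR ?IHi; try lia.
have Ui := @U_ge0 i.+1 d; have eUi := @Ugrad_E i d.
have zi := prev0 i; have zi1 := prev0 i.+1; have reci := rec i ltid.
have belowi := below i.+1; have after_i := after0 i; have after_i1 := after0 i.+1.
have [ltxi|ltix|eqx] := ltngtP x i.+1; try lia.
by rewrite eqx in pos; lia.
Qed.

Hypothesis C_lt_k : forall d, (d < k)%N -> C d = 0.

Lemma push_raised_lt i d : (d < k)%N -> (d < r)%N ->
  push U C i d = 0 /\ push U raised i d = 0.
Proof.
move=> dk dr.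
have U_ge0' i' d' : (0 < i' < d')%N -> (d' < minn k r)%N -> 0 <= U i' d'.
  by move=> ? ?; apply: U_ge0; lia.
split; apply: (push_eq0 U_ge0'); try lia; move=> d' d'k.
  by apply: C_lt_k; lia.
by rewrite /raised C_lt_k; lia.
Qed.

Hypothesis k_gt0 : (0 < k)%N.

Lemma push_raised d : (k <= d < r)%N ->
  let x := turn E (entry E k d) d in
  (forall i, (x <= i <= d)%N -> push U C i d = 0) /\
  (forall i, (i <= d)%N -> push U raised i d = push U C i d + (i < x)%N%:Z).
Proof.
move=> /andP[kd]; elim: d kd => [|d IHd] kd dr; first by lia.
have [eqk|led] : k = d.+1 \/ (k <= d)%N by lia.
  have lt0 i := @push_raised_lt i d ltac:(lia) ltac:(lia).
  apply: push_raised_row; [lia|by have := @entry_bounds E k d.+1; lia|..].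
    by move=> i _ _; case: (lt0 i).
  move=> i id; rewrite eqk entry_start /=.
  by have [-> ->] := lt0 i.
have [zero raise] := IHd led ltac:(lia).
apply: push_raised_row; [lia|by have := @entry_bounds E k d.+1; lia|..].
  by rewrite entryS // => i xi id; apply: zero; lia.
by rewrite entryS // => i id; rewrite raise //=.
Qed.

End Path.

Lemma eq_edges r (h1 h2 : nat -> nat -> int) E :
  (forall i d, (i <= d <= r)%N -> h1 i d = h2 i d) ->
  eq_labels r (edges h1) E -> eq_labels r (edges h2) E.
Proof.
move=> eqh [eq_al eq_bg]; split=> [i d idr|i d id dr].
  by rewrite -eq_al //= !eqh //; lia.
by have [<- <-] := eq_bg i d id dr; rewrite /= !eqh //; lia.
Qed.

(** The vertices of the array of side [r] obtained from the array [h] of side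
    [r.-1] by adding an empty diagonal, raising it [b] times by [omega], and
    adding the paths counted by [C].  Truncating the row index by [minn] sets the
    last right boundary edge to [0]. *)
Definition pushed (r : nat) (h : nat -> nat -> int) (b : int) (C : nat -> int)
    (i d : nat) : int :=
  if (d < r)%N then h i d + push (Ugrad (edges h)) C i d
  else h (minn i r.-1) r.-1 + b + C r.-1.

Lemma eq_pushed r h b C1 C2 : (0 < r)%N ->
  (forall d, (d < r)%N -> C1 d = C2 d) ->
  forall i d, pushed r h b C1 i d = pushed r h b C2 i d.
Proof.
move=> r0 eqC i d; rewrite /pushed; case: ifP => dr.
  by rewrite (eq_push _ eqC).
by rewrite eqC //; lia.
Qed.

Lemma iter_omega_pushed r h b C m E : eq_labels r (edges (pushed r h b C)) E ->
  eq_labels r (edges (pushed r h (b + m%:Z) C)) (iter m (omega r) E).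
Proof.
move=> eqE; elim: m => [|m [IHal IHbg]] /=; first by rewrite addr0.
split=> [i d idr|i d id dr] /=; [rewrite -IHal //|have [<- <-] := IHbg i d id dr].
  by rewrite /= /pushed; case: ifP; do ?[case: ifP]; lia.
by rewrite /= /pushed; do ?[case: ifP]; lia.
Qed.

Lemma iter_chi_edges r g m E : eq_labels r (edges g) E ->
  eq_labels r (edges (fun i d => g i d + (if (i == r) && (d == r) then m else 0%N)%:Z))
    (iter m (chi r) E).
Proof.
move=> eqE; elim: m => [|m [IHal IHbg]] /=.
  by apply: eq_edges eqE => i d _; case: ifP; lia.
split=> [i d idr|i d id dr] /=; [rewrite -IHal //|have [<- <-] := IHbg i d id dr].
  by rewrite /=; do ?[case: ifP]; lia.
by rewrite /=; do ?[case: ifP]; lia.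
Qed.

Section Batch.
Variables (r : nat) (h : nat -> nat -> int).
Hypothesis r_gt0 : (0 < r)%N.
Hypothesis U_ge0 : forall i d, (0 < i < d)%N -> (d < r)%N ->
  0 <= Ugrad (edges h) i d.

Lemma phi_pushed b C k E : (0 < k < r)%N ->
  (forall d, (d < k)%N -> C d = 0) ->
  eq_labels r (edges (pushed r h b C)) E ->
  eq_labels r (edges (pushed r h b (raised C k))) (phi r k E).
Proof.
move=> kr C_lt_k eqE; have /andP[k0 _] := kr.
have UE i d : (i.+1 < d < r)%N ->
  Ugrad E i.+1 d = Ugrad (edges h) i.+1 d
    + push (Ugrad (edges h)) C i.+1 d - push (Ugrad (edges h)) C i.+1 d.-1
    - push (Ugrad (edges h)) C i d + push (Ugrad (edges h)) C i d.-1.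
  move=> idr; have [eq_al _] := eqE.
  rewrite [LHS]/Ugrad -!eq_al; try lia.
  rewrite [al _ _ _]/= [al _ i.+1.-1 d]/= /pushed !ifT; try lia.
  by move: (push _ _) => p; rewrite /Ugrad /=; lia.
apply: eq_edges (phi_edges kr eqE) => i d idr.
rewrite /path_raise /pushed /exit; case: (ltnP d r) => dr; last first.
  by rewrite /raised; lia.
have [dk|kd] := ltnP d k.
  have [-> ->] := push_raised_lt U_ge0 C_lt_k i dk dr; lia.
have [_ ->] := push_raised U_ge0 UE C_lt_k k0 (d := d) ltac:(lia); lia.
Qed.

Lemma iter_phi_pushed b C k m E : (0 < k < r)%N ->
  (forall d, (d < k)%N -> C d = 0) ->
  eq_labels r (edges (pushed r h b C)) E ->
  eq_labels r (edges (pushed r h b (fun d => C d + (if (k <= d)%N then m else 0%N)%:Z)))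
    (iter m (phi r k) E).
Proof.
move=> kr C_lt_k eqE; elim: m => [|m IHm] /=.
  by apply: eq_edges eqE => i d _; apply: eq_pushed => // d' _; case: ifP; lia.
have Cm_lt_k d : (d < k)%N -> C d + (if (k <= d)%N then m else 0%N)%:Z = 0.
  by move=> dk; rewrite C_lt_k // ifF; lia.
apply: eq_edges (phi_pushed kr Cm_lt_k IHm) => i d _.
by apply: eq_pushed => // d' _; rewrite /raised; case: ifP; lia.
Qed.

(** The paths enter by weakly decreasing diagonal, so no diagonal before the
    current one has received a path yet, as [phi_pushed] demands. *)
Lemma foldr_phi_pushed b (v : nat -> nat) E j : (0 < j <= r)%N ->
  eq_labels r (edges (pushed r h b (fun=> 0))) E ->
  eq_labels r
    (edges (pushed r h b (fun d => (\sum_(j <= k < d.+1) v k)%N%:Z)))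
    (foldr (fun k => iter (v k) (phi r k)) E (index_iota j r)).
Proof.
move=> + eqE; have [m] : exists m, (r - j)%N = m by exists (r - j)%N.
elim: m j => [|m IHm] j rj jr.
  rewrite /index_iota rj /=; apply: eq_edges eqE => i d _.
  by apply: eq_pushed => // d' d'r; rewrite big_geq //; lia.
have -> : index_iota j r = j :: index_iota j.+1 r.
  by rewrite /index_iota rj (_ : (r - j.+1)%N = m) //; lia.
have IH := IHm j.+1 ltac:(lia) ltac:(lia); rewrite /=.
have zero d : (d < j)%N -> (\sum_(j.+1 <= k < d.+1) v k)%N%:Z = 0.
  by move=> dj; rewrite big_geq //; lia.
apply: eq_edges (iter_phi_pushed (v j) _ zero IH) => [i d _|]; last by lia.
apply: eq_pushed => // d' _; case: leqP => jd'.
  by rewrite [in RHS]big_ltn; lia.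
by rewrite !big_geq //; lia.
Qed.

Lemma kappa_inv_pushed E : eq_labels r.-1 (edges h) E ->
  eq_labels r (edges (pushed r h 0 (fun=> 0))) (kappa_inv r E).
Proof.
move=> [eq_al eq_bg].
have push0 i d : (d < r)%N -> push (Ugrad (edges h)) (fun=> 0) i d = 0.
  by move=> dr; apply: push_eq0 dr.
split=> [i d idr|i d id dr] /=; case: eqP => [->|dr'].
- by rewrite /pushed ltnn push0 ?ifT ?(minn_idPl _); lia.
- by rewrite -eq_al /pushed ?push0 ?ifT /=; lia.
- have pr : (r.-1 < r)%N by lia.
  have := @eq_bg i r.-1; rewrite /= /pushed ltnn pr push0 //.
  have [ltir|leri] := ltnP i r => eqE; last first.
    have -> : i = r by lia.
    by rewrite minnn (_ : minn r r.-1 = r.-1); lia.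
  have [<- _] := eqE ltac:(lia) ltac:(lia).
  have -> : minn i r.-1 = i by lia.
  by have -> : minn i.-1 r.-1 = i.-1; lia.
have [] := eq_bg i d id ltac:(lia).
by rewrite /= /pushed ?push0 ?ifT /=; lia.
Qed.

End Batch.

(** * The stacked arrays *)

(** Upright gradients carry nonnegativity from the left boundary through the
    [al] and from the diagonal through the [be]; left gradients carry it up the
    diagonal from its last edge. *)
Lemma hive_edges_ge0 n a :
  is_hive n a ->
  (forall k, (1 <= k <= n)%N -> 0 <= al (edges a) 0%N k) ->
  0 <= be (edges a) n n -> is_LR_hive n a.
Proof.
move=> hive_a left_ge0 corner_ge0.
have al_ge0 i j : (i < j <= n)%N -> 0 <= al (edges a) i j.
  elim: i => [|i IHi] ij; first by apply: left_ge0; lia.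
  have [_ /(_ i.+1 j ltac:(lia) ltac:(lia)) []] := hive_a.
  by rewrite /Ugrad /= => _; move: IHi; rewrite /=; lia.
have diag_ge0 i : (0 < i <= n)%N -> 0 <= be (edges a) i i.
  have [m] : exists m, (n - i)%N = m by exists (n - i)%N.
  elim: m i => [|m IHm] i nim id; first by have -> : i = n by lia.
  have [_ /(_ i i.+1 ltac:(lia) ltac:(lia)) []] := hive_a.
  by have := IHm i.+1; rewrite /Lgrad /=; lia.
have be_ge0 i j : (0 < i <= j)%N -> (j <= n)%N -> 0 <= be (edges a) i j.
  elim: j => [|j IHj] ij jn; first by lia.
  have [->|leij] : i = j.+1 \/ (i <= j)%N by lia.
    by apply: diag_ge0; lia.
  have [_ /(_ i j.+1 ltac:(lia) ltac:(lia)) []] := hive_a.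
  by have := IHj ltac:(lia) ltac:(lia); rewrite /Ugrad /=; lia.
split=> // i j ij jn; have beij := be_ge0 i j ij jn; split=> //.
have := al_ge0 i.-1 j ltac:(lia); rewrite /= in beij *; lia.
Qed.

(** The upright gradients of [K] in its [r]-th diagonal, summed over the first
    [d] rhombi. *)
Definition column_rise (K : nat -> nat -> int) (r d : nat) : int :=
  al (edges K) d r - al (edges K) 0%N r.

(** The vertices of the array that the construction reaches after [r] rounds, as
    [slice_build] shows. *)
Fixpoint slice (K : nat -> nat -> int) (r : nat) : nat -> nat -> int :=
  if r is r'.+1 then fun i d =>
    pushed r (slice K r') (be (edges K) r r) (column_rise K r) i d
    + (if (i == r) && (d == r) then al (edges K) 0%N r else 0)
  else fun _ _ => 0.

(** The shift by [K 0 r] makes the boundary values of the tetrahedron symmetric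
    in [K]; the recurrence does not see it. *)
Definition tetra (K : nat -> nat -> int) (i d r : nat) : int :=
  slice K r i d + K 0%N r.

Section Tetrahedron.
Variable K : nat -> nat -> int.

Lemma sliceS_lt r i d : (d <= r)%N ->
  slice K r.+1 i d
  = slice K r i d + push (Ugrad (edges (slice K r))) (column_rise K r.+1) i d.
Proof. by move=> dr; rewrite /= /pushed !ltnS dr; case: ifP; lia. Qed.

(** In vertex labels the bumping recursion of [push] is the octahedron
    recurrence. *)
Lemma tetra_rec i d r : (i < d < r)%N ->
  tetra K i d r + tetra K i.+1 d.+1 r.+1
  = Num.max (tetra K i d r.+1 + tetra K i.+1 d.+1 r)
            (tetra K i d.+1 r.+1 + tetra K i.+1 d r).
Proof.
move=> idr; rewrite /tetra !sliceS_lt; try lia.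
rewrite [push _ _ i.+1 d.+1]/= ifT; last by lia.
move: (push _ _ i d) (push _ _ i d.+1) => p q.
by rewrite /Ugrad /=; lia.
Qed.

Hypothesis K00 : K 0%N 0%N = 0.

Lemma tetra_face d r : (d <= r)%N -> tetra K 0%N d r = K d r.
Proof.
rewrite /tetra; elim: r d => [|r IHr] d dr.
  have -> : d = 0%N by lia.
  by rewrite /= K00.
have [->|led] : d = r.+1 \/ (d <= r)%N by lia.
  by have := IHr r; rewrite /= /pushed ltnn min0n /column_rise /=; lia.
by rewrite sliceS_lt //=; have := IHr d; rewrite /column_rise /=; lia.
Qed.

Lemma tetra_last i r : (i <= r)%N -> tetra K i r r = K r r + K 0%N i.
Proof.
rewrite /tetra; elim: r i => [|r IHr] i ir.
  have -> : i = 0%N by lia.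
  by rewrite /= K00.
have := IHr (minn i r) ltac:(lia).
rewrite /= /pushed ltnn eqxx andbT /column_rise /=.
have [->|lei] : i = r.+1 \/ (i <= r)%N by lia.
  by rewrite eqxx (_ : minn r.+1 r = r); lia.
by rewrite (_ : minn i r = i) ?ifF; lia.
Qed.

Lemma tetra_diag d r : (d <= r)%N -> tetra K d d r = K d d + K 0%N r.
Proof.
elim: r => [|r IHr] dr; first by rewrite (_ : d = 0%N) /tetra /= ?K00; lia.
have [->|led] : d = r.+1 \/ (d <= r)%N by lia.
  exact: tetra_last.
rewrite /tetra in IHr *; rewrite sliceS_lt //; case: d {dr} led IHr => [|d] led IHr.
  by have := IHr led; rewrite /= /column_rise /=; lia.
by rewrite push_diag; have := IHr led; lia.
Qed.

Lemma tetra_octahedral n : octahedral n (tetra K).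
Proof.
split=> i d r idr rn.
- have [eqi|ltid] : i = d \/ (i < d)%N by lia.
    by rewrite eqi !tetra_diag; lia.
  by have := @tetra_rec i d r; lia.
- have [eqd|ltdr] : d = r \/ (d < r)%N by lia.
    by rewrite eqd !tetra_last; lia.
  by have := @tetra_rec i d r; lia.
have [eqd|ltdr] : d = r \/ (d < r)%N by lia.
  by right; rewrite eqd !tetra_last; lia.
have [eqi|ltid] : i = d \/ (i < d)%N by lia.
  by left; rewrite eqi !tetra_diag; lia.
by have := @tetra_rec i d r; lia.
Qed.

Lemma slice_is_hive n r : is_hive n K -> (r <= n)%N -> is_hive r (slice K r).
Proof.
move=> hiveK rn; split.
  by have := tetra_face (leq0n r); rewrite /tetra; lia.
move=> i j ij jr.
have hive0 : is_hive n (tetra K 0%N).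
  split; first by rewrite tetra_face.
  move=> i' j' ij' jn'; have [_ /(_ i' j' ij' jn')] := hiveK.
  by rewrite /Rgrad /Ugrad /Lgrad /= !tetra_face; try lia.
have [||R U L] := octahedral_slice_hive (tetra_octahedral n) hive0 _ _ rn ij jr.
- by move=> d r' dr; rewrite !tetra_face ?tetra_diag; lia.
- by move=> d r' dr; rewrite !tetra_face ?tetra_last; lia.
by move: R U L; rewrite /Rgrad /Ugrad /Lgrad /tetra /=; split; lia.
Qed.

End Tetrahedron.

(** * The construction *)

Lemma omega_expE n mu K r : (r <= n)%N ->
  be (edges K) r n = (part mu r)%:Z ->
  omega_exp n mu (Ugrad (edges K)) r = be (edges K) r r.
Proof.
move=> rn bd; rewrite /omega_exp -bd.
suff -> : \sum_(r.+1 <= j < n.+1) Ugrad (edges K) r j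
          = be (edges K) r n - be (edges K) r r by lia.
rewrite big_add1 -(telescope_sumr (be (edges K) r)) //.
by apply: eq_bigr => j _; rewrite /Ugrad /=; lia.
Qed.

Lemma column_riseE n K r d : is_hive n K -> (d < r <= n)%N ->
  column_rise K r d = (\sum_(1 <= k < d.+1) `|Ugrad (edges K) k r|)%N%:Z.
Proof.
move=> [_ hiveK]; elim: d => [|d IHd] dr.
  by rewrite big_geq // /column_rise subrr.
have [||_ U_ge0 _] := hiveK d.+1 r; [lia..|].
rewrite big_nat_recr //= PoszD -IHd; last by lia.
by move: U_ge0; rewrite /column_rise /Ugrad /=; lia.
Qed.

(** One round of the construction is one step in [r] of the tetrahedron.  The
    hive property of the previous slice enters through its upright gradients,
    which have to be nonnegative for the path additions to act by [push]. *)
Lemma slice_build n la mu nu K r : LR_hives n la nu mu K -> (r <= n)%N ->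
  eq_labels r (edges (slice K r)) (build n mu nu (Ugrad (edges K)) r).
Proof.
move=> [[hiveK _ beK_ge0] bdK]; have [K00 _] := hiveK.
elim: r => [|r IHr] rn.
  by split=> i j ij; [rewrite /= subrr|lia].
have [_ left_r right_r] := bdK r.+1 ltac:(lia).
have [_ slice_hive_r] := slice_is_hive K00 hiveK (ltnW rn).
have U_ge0 i d : (0 < i < d)%N -> (d < r.+1)%N ->
    0 <= Ugrad (edges (slice K r)) i d.
  by move=> id dr; have [] := slice_hive_r i d id dr.
have b_ge0 : 0 <= be (edges K) r.+1 r.+1.
  by have [] := beK_ge0 r.+1 r.+1 ltac:(lia) ltac:(lia).
have step0 := kappa_inv_pushed (ltn0Sn r) U_ge0 (IHr (ltnW rn)).
have step1 := iter_omega_pushed `|omega_exp n mu (Ugrad (edges K)) r.+1|%N step0.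
have step2 := foldr_phi_pushed (ltn0Sn r) U_ge0
  (fun k => `|Ugrad (edges K) k r.+1|%N) (j := 1) (isT : (0 < 1 <= r.+1)%N) step1.
have := iter_chi_edges (part nu r.+1) step2.
apply: eq_edges => i d id; rewrite omega_expE // add0r gez0_abs //.
rewrite [RHS]/=; move: left_r => /= ->.
congr (_ + _); last by case: ifP.
by apply: eq_pushed => // d' d'r; rewrite -(column_riseE hiveK) //; lia.
Qed.

Theorem theorem9p3 (n : nat) (la mu nu : seq nat) (K : nat -> nat -> int)
  (hn : (0 < n)%N)
  (hla : is_partition la) (hmu : is_partition mu) (hnu : is_partition nu)
  (hlen : (plen la <= n)%N)
  (hmula : psub mu la) (hnula : psub nu la)
  (hsize : psize la = (psize mu + psize nu)%N)
  (hK : LR_hives n la nu mu K) :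
  exists H : nat -> nat -> int,
    eq_labels n (edges H) (build n mu nu (Ugrad (edges K)) n) /\
    LR_hives n la mu nu H.
Proof.
exists (slice K n); split; first exact: slice_build hK (leqnn n).
have [[hiveK _ _] bdK] := hK; have [K00 _] := hiveK.
have bottom k : (1 <= k <= n)%N ->
    ga (edges (slice K n)) k k = (part la k)%:Z.
  move=> kn; have [<- _ _] := bdK k kn.
  have := tetra_diag K00 (d := k) (r := n) ltac:(lia).
  have := tetra_diag K00 (d := k.-1) (r := n) ltac:(lia).
  by rewrite /tetra /=; lia.
have left k : (1 <= k <= n)%N ->
    al (edges (slice K n)) 0%N k = (part mu k)%:Z.
  move=> kn; have [_ _ <-] := bdK k kn.
  have := tetra_face K00 (d := k) (r := n) ltac:(lia).
  have := tetra_face K00 (d := k.-1) (r := n) ltac:(lia).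
  by rewrite /tetra /=; lia.
have right k : (1 <= k <= n)%N ->
    be (edges (slice K n)) k n = (part nu k)%:Z.
  move=> kn; have [_ <- _] := bdK k kn.
  have := tetra_last K00 (i := k) (r := n) ltac:(lia).
  have := tetra_last K00 (i := k.-1) (r := n) ltac:(lia).
  by rewrite /tetra /=; lia.
split; last by move=> k kn; rewrite bottom ?left ?right.
apply: hive_edges_ge0; first exact: slice_is_hive hiveK (leqnn n).
  by move=> k kn; rewrite left.
by rewrite right ?leqnn ?hn.
Qed.
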